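(* Each of the following is a family of Kaprekar 2-cycles, where the two members $C,D$ of each 2-cycle are described by their digit rearrangements in descending order: in each case there is a Kaprekar 2-cycle $\{C,D\}$ for which the pair $\{\overline{C},\overline{D}\}$ is the displayed pair. \begin{enumerate} \item $\{95553,\ 99954\}$; \item $\{9_{2}6_{x+1}5_{2}4_{2}3_{x}2_{1}1_{1},\ 9_{1}8_{2}7_{2}6_{x}3_{x}2_{3}0_{1}\}$, for every integer $x\geq 2$; \item $\{9_z8_{z-v-u}7_{z+v}6_{z-v}5_z4_z3_{z-v}2_{z+v}1_{z-v-u},\ 9_z8_{z-v-u}7_{z+u}6_{z-u}5_z4_z3_{z-u}2_{z+u}1_{z-v-u}\}$, for all nonnegative integers $u$, $v$, $z$ with $z>u+v>0$ and $u\neq v$. \end{enumerate}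
   Context: All integers are written in base 10. Fix a number of digits $n$; integers are written with exactly $n$ decimal digits, padded with leading zeros if necessary. For such an integer $N$, $\overline{N}$ and $\underline{N}$ denote the numbers obtained by writing the $n$ digits of $N$ in descending and ascending order respectively, and $k(N)=\overline{N}-\underline{N}$, again regarded as an $n$-digit number (padded with leading zeros if necessary). A Kaprekar 2-cycle is a pair $\{C,D\}$ of distinct $n$-digit integers (for some $n$) with $k(C)=D$ and $k(D)=C$. Notation: for a digit $\delta$ and an integer $m\ge 0$, $\delta_m$ denotes $m$ consecutive copies of the digit $\delta$; so e.g. $9_26_35_1$ is the number $996665$. *)

(* Defs.v *)
From mathcomp Require Import all_boot.

Set Implicit Arguments.
Unset Strict Implicit.
Unset Printing Implicit Defensive.

(* Digit sequences are written most significant digit first, as on paper. *)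

Definition from_digits (s : seq nat) : nat := foldl (fun a d => 10 * a + d) 0 s.

(* For N < 10 ^ n: the decimal expansion of N padded with leading zeros to
   length n. *)
Definition digits (n N : nat) : seq nat :=
  rev (mkseq (fun i => (N %/ 10 ^ i) %% 10) n).

Definition descending (n N : nat) : nat := from_digits (sort geq (digits n N)).

Definition ascending (n N : nat) : nat := from_digits (sort leq (digits n N)).

(* Truncated subtraction is harmless here: ascending n N <= descending n N. *)
Definition kaprekar (n N : nat) : nat := descending n N - ascending n N.

Definition kaprekar_2cycle (n C D : nat) : Prop :=
  [/\ C < 10 ^ n, D < 10 ^ n, C != D, kaprekar n C = D & kaprekar n D = C].

(* Some Kaprekar 2-cycle {C, D} has as its unordered pair of descending
   rearrangements the pair of n-digit numbers with digit sequences s and t;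
   =i between two-element sequences is equality of the underlying sets. *)
Definition describes_2cycle (s t : seq nat) : Prop :=
  exists n C D,
    [/\ size s = n, size t = n, kaprekar_2cycle n C D
      & [:: descending n C; descending n D]
          =i [:: from_digits s; from_digits t]].

(* The string delta_m ... delta'_m' is written with the library's tally_seq:
   tally_seq [:: (9, 2); (6, 3); (5, 1)] = [:: 9; 9; 6; 6; 6; 5]. *)

(* Main.v *)
(* In both infinite families, aligning the runs of the descending rearrangement
   s with those of its reversal gives a common refinement whose shape does not
   depend on the parameters, so the subtraction can be carried out run by run.
   Its digits are a permutation of t, and symmetrically with s and t exchanged.
   In the last family t is obtained from s by exchanging u and v, so that a
   single subtraction suffices. *)
Require Import Defs.
From mathcomp Require Import all_boot zify ring.

Set Implicit Arguments.
Unset Strict Implicit.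
Unset Printing Implicit Defensive.

(** * Positional value of digit sequences *)

Lemma from_digits_rcons s d : from_digits (rcons s d) = 10 * from_digits s + d.
Proof. by rewrite /from_digits foldl_rcons. Qed.

Lemma from_digits_cat s t :
  from_digits (s ++ t) = from_digits s * 10 ^ size t + from_digits t.
Proof.
elim/last_ind: t => [|t d IHt]; first by rewrite cats0 muln1 addn0.
by rewrite -rcons_cat !from_digits_rcons IHt size_rcons expnS; lia.
Qed.

Lemma from_digits_cons d s :
  from_digits (d :: s) = d * 10 ^ size s + from_digits s.
Proof. by rewrite -cat1s from_digits_cat. Qed.

Lemma from_digits_lt s : all (gtn 10) s -> from_digits s < 10 ^ size s.
Proof.
elim: s => [|d s IHs] //= /andP[d_lt /IHs s_lt].
by rewrite from_digits_cons expnS; nia.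
Qed.

Lemma digitsS n N : digits n.+1 N = rcons (digits n (N %/ 10)) (N %% 10).
Proof.
rewrite /digits /mkseq /= rev_cons expn0 divn1; congr (rcons (rev _) _).
rewrite (iotaDl 1 0) -map_comp; apply: eq_map => i /=.
by rewrite add1n expnS divnMA.
Qed.

Lemma from_digitsK s : all (gtn 10) s -> digits (size s) (from_digits s) = s.
Proof.
elim/last_ind: s => [|s d IHs] //; rewrite all_rcons => /andP[d_lt /IHs sK].
rewrite size_rcons from_digits_rcons digitsS mulnC divnMDl // divn_small //.
by rewrite addn0 sK modnMDl modn_small.
Qed.

Section SortedDigits.

Variables s c : seq nat.
Hypotheses (s_sorted : sorted geq s) (s_digits : all (gtn 10) s).
Hypothesis cs : perm_eq c s.

Let c_digits : all (gtn 10) c. Proof. by rewrite (perm_all _ cs). Qed.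

(** A sorted sequence is determined by its multiset of digits, so sorting any rearrangement [c]
    gives back [s]. *)
Lemma descending_perm : descending (size s) (from_digits c) = from_digits s.
Proof.
rewrite /descending -(perm_size cs) from_digitsK //; congr from_digits.
apply: (@sorted_eq _ geq) => //; last by rewrite perm_sort.
- by move=> y x z /= ? ?; lia.
- by move=> x y /= ?; lia.
- by apply: sort_sorted => x y /=; lia.
Qed.

Lemma ascending_perm : ascending (size s) (from_digits c) = from_digits (rev s).
Proof.
rewrite /ascending -(perm_size cs) from_digitsK //; congr from_digits.
apply: (@sorted_eq _ leq leq_trans anti_leq).
- exact: sort_sorted leq_total _.
- by rewrite rev_sorted.
- by rewrite perm_sort perm_sym perm_rev perm_sym.
Qed.

End SortedDigits.

(** * Column arithmetic with carries *)

(* Incoming carry c, outgoing carry c'; with c = c' = 0 this is a - b = d. *)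
Definition adds_to (c c' : nat) (a b d : seq nat) : Prop :=
  [/\ size b = size a, size d = size a &
      from_digits b + from_digits d + c = from_digits a + c' * 10 ^ size a].

Lemma adds_to_nil c : adds_to c c [::] [::] [::].
Proof. by split; rewrite //= muln1. Qed.

Lemma adds_to_cons c1 c c' x y w a b d :
  y + w + c1 = x + 10 * c' -> adds_to c c1 a b d ->
  adds_to c c' (x :: a) (y :: b) (w :: d).
Proof.
move=> col [sz_b sz_d IH]; split; rewrite /= ?sz_b ?sz_d //.
by rewrite !from_digits_cons sz_b sz_d expnS; nia.
Qed.

(** Each column of the run takes in and hands on the same carry [c'], so the length [n] can stay
    symbolic. *)
Lemma adds_to_nseq n c c' x y w a b d :
  y + w + c' = x + 10 * c' -> adds_to c c' a b d ->
  adds_to c c' (nseq n x ++ a) (nseq n y ++ b) (nseq n w ++ d).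
Proof. by move=> col abd; elim: n => //= n; apply: adds_to_cons. Qed.

Lemma adds_to_run n c c' x y w a b d :
  y + w + c' = x + 10 * c' ->
  adds_to c c' (tally_seq a) (tally_seq b) (tally_seq d) ->
  adds_to c c' (tally_seq ((x, n) :: a)) (tally_seq ((y, n) :: b))
    (tally_seq ((w, n) :: d)).
Proof. exact: adds_to_nseq. Qed.

(** Needed where the carry changes: such a column is split off as a run of length 1. *)
Lemma adds_to_digit c1 c c' x y w a b d :
  y + w + c1 = x + 10 * c' ->
  adds_to c c1 (tally_seq a) (tally_seq b) (tally_seq d) ->
  adds_to c c' (tally_seq ((x, 1) :: a)) (tally_seq ((y, 1) :: b))
    (tally_seq ((w, 1) :: d)).
Proof. exact: adds_to_cons. Qed.

(** Works from the most significant end: the outgoing carry is known and the incoming one is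
    guessed. Concrete digits make a wrong guess fail at once. *)
Ltac add_runs :=
  repeat first
    [ exact: adds_to_nil
    | apply: adds_to_run; first by []
    | apply: (@adds_to_digit 0); first by []
    | apply: (@adds_to_digit 1); first by [] ].

Lemma kaprekar_perm s c d :
  sorted geq s -> all (gtn 10) s -> perm_eq c s -> adds_to 0 0 s (rev s) d ->
  kaprekar (size s) (from_digits c) = from_digits d.
Proof.
move=> s_sorted s_digits cs [_ _]; rewrite addn0 mul0n addn0 => sumE.
by rewrite /kaprekar descending_perm // ascending_perm // -sumE addKn.
Qed.

Lemma describes_2cycle_perm s t c d :
    sorted geq s -> sorted geq t -> all (gtn 10) s -> all (gtn 10) t ->
    perm_eq c s -> perm_eq d t -> s <> t ->
    adds_to 0 0 s (rev s) d -> adds_to 0 0 t (rev t) c ->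
  describes_2cycle s t.
Proof.
move=> s_sorted t_sorted s_lt t_lt cs dt neq_st s_sub t_sub.
have size_t : size t = size s by case: s_sub => _ <- _; rewrite (perm_size dt).
have c_lt : all (gtn 10) c by rewrite (perm_all _ cs).
have d_lt : all (gtn 10) d by rewrite (perm_all _ dt).
have desc_c := descending_perm s_sorted s_lt cs.
have desc_d := descending_perm t_sorted t_lt dt.
exists (size s), (from_digits c), (from_digits d); split=> //; last first.
  by rewrite desc_c -size_t desc_d.
split.
- by rewrite -(perm_size cs) from_digits_lt.
- by rewrite -size_t -(perm_size dt) from_digits_lt.
(* Equal members would have equal descending rearrangements, and these determine [s] and [t]. *)
- apply/eqP => eq_cd; apply: neq_st.
  by rewrite -(from_digitsK s_lt) -(from_digitsK t_lt) -desc_c -desc_d size_t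
    eq_cd.
- exact: kaprekar_perm.
- by rewrite -size_t; apply: kaprekar_perm.
Qed.

(** * Sequences given by runs *)

Section TallySeq.

Implicit Type bs : seq (nat * nat).

Lemma tally_seq_merge x m n bs :
  tally_seq ((x, m) :: (x, n) :: bs) = tally_seq ((x, m + n) :: bs).
Proof. by rewrite /tally_seq /= nseqD catA. Qed.

Lemma eq_tally_seq_cons x m n bs1 bs2 :
  m = n -> tally_seq bs1 = tally_seq bs2 ->
  tally_seq ((x, m) :: bs1) = tally_seq ((x, n) :: bs2).
Proof. by move=> -> eq_bs; rewrite /tally_seq /= -/(tally_seq _) eq_bs. Qed.

Lemma rev_tally_seq bs : rev (tally_seq bs) = tally_seq (rev bs).
Proof.
elim: bs => [|b bs IHbs] //=.
by rewrite rev_cat IHbs rev_nseq rev_cons /tally_seq map_rcons flatten_rcons.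
Qed.

Lemma all_tally_seq p bs : all p (unzip1 bs) -> all p (tally_seq bs).
Proof.
elim: bs => [|b bs IHbs] //= /andP[pb /IHbs p_bs].
by rewrite all_cat all_nseq pb orbT.
Qed.

Lemma count_tally_seq p bs :
  count p (tally_seq bs) = sumn [seq p b.1 * b.2 | b <- bs].
Proof. by elim: bs => [|b bs IHbs] //=; rewrite count_cat count_nseq IHbs. Qed.

Lemma sorted_tally_seq bs :
  sorted gtn (unzip1 bs) -> sorted geq (tally_seq bs).
Proof.
have gtn_trans : transitive gtn by move=> y x z /= ? ?; lia.
elim: bs => [|[x n] bs IHbs] //= x_bs.
have x_max : all (geq x) (tally_seq bs).
  apply: all_tally_seq.
  by apply: sub_all (order_path_min gtn_trans x_bs) => y /ltnW.
have sorted_bs := IHbs (path_sorted x_bs).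
elim: n => //= n IHn; rewrite path_min_sorted // all_cat all_nseq /= leqnn orbT.
exact: x_max.
Qed.

End TallySeq.

Definition family2_s x : seq (nat * nat) :=
  [:: (9, 2); (6, x + 1); (5, 2); (4, 2); (3, x); (2, 1); (1, 1)].

Definition family2_t x : seq (nat * nat) :=
  [:: (9, 1); (8, 2); (7, 2); (6, x); (3, x); (2, 3); (0, 1)].

Definition family3_s u v z : seq (nat * nat) :=
  [:: (9, z); (8, z - v - u); (7, z + v); (6, z - v); (5, z); (4, z);
      (3, z - v); (2, z + v); (1, z - v - u)].

(** Merges adjacent runs of the refined side until the digits match; [lia] compares the lengths. *)
Ltac merge_runs :=
  rewrite ?rev_tally_seq /family2_s /family2_t /family3_s /rev /=;
  repeat first
    [ reflexivity
    | rewrite !tally_seq_merge; apply: eq_tally_seq_cons; first by lia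
    | apply: eq_tally_seq_cons; first by lia ].

(** Counting under an arbitrary [p] yields a polynomial identity in the values of [p] and the run
    lengths; [ring] on [nat] needs these lengths free of subtraction. *)
Ltac perm_runs :=
  apply/permP => p; rewrite !count_tally_seq /=; ring.

(** * The two infinite families *)

Lemma family2 x : 2 <= x ->
  describes_2cycle (tally_seq (family2_s x)) (tally_seq (family2_t x)).
Proof.
(* One difference has runs of lengths x - 2 and x - 1; with x = y + 2 they become [y] and [y.+1]. *)
move=> x_ge2; have -> : x = (x - 2).+2 by lia.
move: (x - 2) => {x_ge2} y.
apply: (@describes_2cycle_perm _ _
  (tally_seq [:: (9, 1); (6, 1); (6, 1); (5, 1); (4, 1); (3, y); (2, 1); (9, 1);
     (6, y.+1); (5, 1); (4, 1); (3, 1); (3, 1); (1, 1)])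
  (tally_seq [:: (8, 1); (7, 1); (3, y.+2); (2, 1); (0, 1); (9, 1); (8, 1);
     (7, 1); (6, y.+2); (2, 1); (2, 1)])).
- exact: sorted_tally_seq.
- exact: sorted_tally_seq.
- exact: all_tally_seq.
- exact: all_tally_seq.
- perm_runs.
- perm_runs.
(* The second digits, 9 and 8, already differ. *)
- by [].
- have -> : rev (tally_seq (family2_s y.+2)) =
    tally_seq [:: (1, 1); (2, 1); (3, y.+2); (4, 1); (4, 1); (5, 1); (5, 1);
      (6, 1); (6, y.+2); (9, 1); (9, 1)] by merge_runs.
  have -> : tally_seq (family2_s y.+2) =
    tally_seq [:: (9, 1); (9, 1); (6, y.+2); (6, 1); (5, 1); (5, 1); (4, 1);
      (4, 1); (3, y.+2); (2, 1); (1, 1)] by merge_runs.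
  add_runs.
have -> : rev (tally_seq (family2_t y.+2)) =
  tally_seq [:: (0, 1); (2, 1); (2, 1); (2, 1); (3, 1); (3, y); (3, 1); (6, 1);
    (6, y.+1); (7, 1); (7, 1); (8, 1); (8, 1); (9, 1)] by merge_runs.
have -> : tally_seq (family2_t y.+2) =
  tally_seq [:: (9, 1); (8, 1); (8, 1); (7, 1); (7, 1); (6, y); (6, 1); (6, 1);
    (3, y.+1); (3, 1); (2, 1); (2, 1); (2, 1); (0, 1)] by merge_runs.
add_runs.
Qed.

(** The run-by-run difference of [family3_s u v z] and its reversal. A borrow arises in the last
    column (11 - 9 = 2) and persists up to the last column of 6 - 4, which it turns into the
    isolated 1. *)
Definition family3_diff u v z : seq (nat * nat) :=
  [:: (8, z - v - u); (7, v + u); (6, z - v - u); (5, v); (4, z - v); (3, v);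
      (2, (z - v).-1); (1, 1); (9, z); (7, z - v); (6, v); (5, z - v); (4, v);
      (3, z - v - u); (2, v + u); (1, (z - v - u).-1); (2, 1)].

Lemma family3_sC u v z :
  family3_s v u z =
  [:: (9, z); (8, z - v - u); (7, z + u); (6, z - u); (5, z); (4, z);
      (3, z - u); (2, z + u); (1, z - v - u)].
Proof. by rewrite /family3_s subnAC. Qed.

Lemma family3_adds_to u v z : u + v < z ->
  adds_to 0 0 (tally_seq (family3_s u v z)) (rev (tally_seq (family3_s u v z)))
    (tally_seq (family3_diff u v z)).
Proof.
move=> uv_lt_z.
have -> : rev (tally_seq (family3_s u v z)) =
  tally_seq [:: (1, z - v - u); (2, v + u); (2, z - v - u); (2, v); (3, z - v);
    (4, v); (4, (z - v).-1); (4, 1); (5, z); (6, z - v); (7, v); (7, z - v);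
    (7, v); (8, z - v - u); (9, v + u); (9, (z - v - u).-1); (9, 1)].
  by merge_runs.
have -> : tally_seq (family3_s u v z) =
  tally_seq [:: (9, z - v - u); (9, v + u); (8, z - v - u); (7, v); (7, z - v);
    (7, v); (6, (z - v).-1); (6, 1); (5, z); (4, z - v); (4, v); (3, z - v);
    (2, v); (2, z - v - u); (2, v + u); (1, (z - v - u).-1); (1, 1)].
  by merge_runs.
add_runs.
Qed.

Lemma family3_diff_perm u v z : u + v < z ->
  perm_eq (tally_seq (family3_diff u v z)) (tally_seq (family3_s v u z)).
Proof.
(* The slack [w] turns every truncated subtraction into a sum, as [ring] requires. *)
move=> uv_lt_z; have [w ->] : exists w, z = w.+1 + u + v.
  by exists (z - u - v).-1; lia.
have zBu : w.+1 + u + v - u = w.+1 + v by rewrite addnAC addnK.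
by rewrite /family3_diff /family3_s zBu !addnK !addSn /=; perm_runs.
Qed.

Lemma family3 u v z : u + v < z -> u != v ->
  describes_2cycle (tally_seq (family3_s u v z)) (tally_seq (family3_s v u z)).
Proof.
move=> uv_lt_z neq_uv; have vu_lt_z : v + u < z by rewrite addnC.
apply: (describes_2cycle_perm _ _ _ _ (family3_diff_perm vu_lt_z)
  (family3_diff_perm uv_lt_z) _ (family3_adds_to uv_lt_z)
  (family3_adds_to vu_lt_z)).
- exact: sorted_tally_seq.
- exact: sorted_tally_seq.
- exact: all_tally_seq.
- exact: all_tally_seq.
(* The digit 7 occurs z + v times on one side and z + u times on the other. *)
by move=> /(congr1 (count_mem 7)); rewrite !count_tally_seq /=; lia.
Qed.

Lemma cycle_95553_99954 :
  describes_2cycle [:: 9; 5; 5; 5; 3] [:: 9; 9; 9; 5; 4].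
Proof.
(* 99954 - 45999 = 53955 and 95553 - 35559 = 59994. *)
by apply: (@describes_2cycle_perm _ _ [:: 5; 3; 9; 5; 5] [:: 5; 9; 9; 9; 4]).
Qed.

Theorem theorem1p2 :
  [/\ describes_2cycle [:: 9; 5; 5; 5; 3] [:: 9; 9; 9; 5; 4],
      forall x : nat, 2 <= x ->
        describes_2cycle
          (tally_seq [:: (9, 2); (6, x + 1); (5, 2); (4, 2); (3, x); (2, 1);
                         (1, 1)])
          (tally_seq [:: (9, 1); (8, 2); (7, 2); (6, x); (3, x); (2, 3);
                         (0, 1)])
    & forall u v z : nat, u + v < z -> 0 < u + v -> u != v ->
        describes_2cycle
          (tally_seq [:: (9, z); (8, z - v - u); (7, z + v); (6, z - v);
                         (5, z); (4, z); (3, z - v); (2, z + v);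
                         (1, z - v - u)])
          (tally_seq [:: (9, z); (8, z - v - u); (7, z + u); (6, z - u);
                         (5, z); (4, z); (3, z - u); (2, z + u);
                         (1, z - v - u)])].
Proof.
split; [exact: cycle_95553_99954 | exact: family2 |].
by move=> u v z uv_lt_z _ neq_uv; rewrite -family3_sC; apply: family3.
Qed.
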